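(* Let $0<q<1$, let $\{\omega_n(z;q)\}_{n\in\mathbb N_0}$ be an even $q$-Lidstone polynomial sequence of type I with associated numerical sequence $(\gamma_{2n})_{n\ge0}$, let $(\xi_{2n})_{n\ge0}$ be the sequence determined by $(\gamma_{2n})_n$ as in the context, and let $\{\hat\omega_n(z;q)\}_{n\in\mathbb N_0}$ be the conjugate sequence. Then for every $n\in\mathbb N_0$ $$\omega_n(z;q)= \frac{1}{\xi_0}\Big[z^{2n}-\sum_{k=0}^{n-1} {2n \brack 2k}_q\, \xi_{2(n-k)}\, \omega_k(z;q)\Big],$$ $$\hat{\omega}_n(z;q)= \frac{1}{\gamma_0}\Big[z^{2n}-\sum_{k=0}^{n-1} {2n \brack 2k}_q\, \gamma_{2(n-k)}\, \hat{\omega}_k(z;q)\Big].$$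
   Context: Fix $0<q<1$. Put $[m]_q=\frac{1-q^m}{1-q}$, $[m]_q!=\prod_{j=1}^m[j]_q$, $[0]_q!=1$, and ${n \brack k}_q=\frac{[n]_q!}{[k]_q!\,[n-k]_q!}$ for $0\le k\le n$. $\mathbb N=\{1,2,\dots\}$, $\mathbb N_0=\mathbb N\cup\{0\}$. The Jackson $q$-derivative is $D_qf(z)=\frac{f(qz)-f(z)}{(q-1)z}$ for $z\ne0$ and $D_qf(0)=f'(0)$, so $D_qz^m=[m]_qz^{m-1}$. An even $q$-Lidstone polynomial sequence of type I (class $q$ELS-I) is a sequence $\{\omega_n(z;q)\}_{n\in\mathbb N_0}$ of polynomials in $z$ with real coefficients such that $D_q^2\omega_n(z;q)=[2n]_q[2n-1]_q\,\omega_{n-1}(z;q)$ for $n\in\mathbb N$, $D_q\omega_n(0;q)=0$ for $n\in\mathbb N_0$, and $\omega_0(z;q)=\gamma_0$ with $\gamma_0\in\mathbb R\setminus\{0\}$. Its associated numerical sequence is $\gamma_{2n}:=\omega_n(0;q)$, and $\omega_n(z;q)=\sum_{k=0}^n{2n \brack 2k}_q\gamma_{2(n-k)}z^{2k}$. The sequence $(\xi_{2n})_{n\ge0}$ is the unique real sequence with $\sum_{j=0}^n\frac{\gamma_{2j}\,\xi_{2(n-j)}}{[2j]_q!\,[2(n-j)]_q!}=\delta_{n0}$ for all $n\in\mathbb N_0$. The conjugate sequence of $\{\omega_n\}_n$ is $\hat\omega_n(z;q)=\sum_{k=0}^n{2n \brack 2k}_q\xi_{2(n-k)}z^{2k}$.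 Empty sums are $0$. *)

(* Defs.v *)
From HB Require Import structures.
From mathcomp Require Import all_boot all_order all_algebra.
From mathcomp Require Import all_classical all_reals all_analysis.

Set Implicit Arguments.
Unset Strict Implicit.
Unset Printing Implicit Defensive.

Import Order.TTheory GRing.Theory Num.Theory.
Import numFieldNormedType.Exports.

Local Open Scope ring_scope.

Definition qint (R : realType) (q : R) (m : nat) : R := (1 - q ^+ m) / (1 - q).

Definition qfact (R : realType) (q : R) (m : nat) : R :=
  \prod_(1 <= j < m.+1) qint q j.

(* Only meaningful for k <= n (the subtraction on nat is truncated). *)
Definition qbinom (R : realType) (q : R) (n k : nat) : R :=
  qfact q n / (qfact q k * qfact q (n - k)).

Definition Dq (R : realType) (q : R) (f : R -> R) (z : R) : R :=
  if z == 0 then f^`()%classic 0 else (f (q * z) - f z) / ((q - 1) * z).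

Definition qELS_I (R : realType) (q : R) (omega : nat -> {poly R}) : Prop :=
  [/\ forall n : nat, (0 < n)%N -> forall z : R,
        Dq q (Dq q (fun x => (omega n).[x])) z =
        qint q n.*2 * qint q (n.*2 - 1) * (omega n.-1).[z],
      forall n : nat, Dq q (fun x => (omega n).[x]) 0 = 0
    & exists2 gamma0 : R, gamma0 != 0 & omega 0%N = gamma0%:P].

(* Sequences with even subscripts are indexed by half the subscript:
   the n-th term below is gamma_{2n}, and likewise xi n is xi_{2n}. *)
Definition assoc_seq (R : realType) (omega : nat -> {poly R}) (n : nat) : R :=
  (omega n).[0].

Definition reciprocal_seq (R : realType) (q : R) (gamma xi : nat -> R) : Prop :=
  forall n : nat,
    \sum_(0 <= j < n.+1)
      gamma j * xi (n - j)%N / (qfact q j.*2 * qfact q (n - j).*2)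
    = (n == 0%N)%:R.

Definition conjugate_seq (R : realType) (q : R) (xi : nat -> R) (n : nat) :
    {poly R} :=
  \sum_(0 <= k < n.+1) (qbinom q n.*2 k.*2 * xi (n - k)%N) *: 'X^(k.*2).

(* Main.v *)
(** In terms of exponential generating functions in the q-factorials, [omega]
    is the product of the even series of [gamma] with the q-analogue of
    [cosh (z t)], and the conjugate sequence is the same with [xi] in place of
    [gamma].  Since the series of [gamma] and [xi] are inverse to each other,
    multiplying [omega] by the series of [xi] leaves the monomials [z^(2n)];
    isolating the last term of this convolution gives the first recurrence,
    and exchanging [gamma] and [xi] gives the second. *)

Require Import Defs.
From HB Require Import structures.
From mathcomp Require Import all_boot all_order all_algebra.
From mathcomp Require Import all_classical all_reals all_analysis.
From mathcomp Require Import zify ring.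

Set Implicit Arguments.
Unset Strict Implicit.
Unset Printing Implicit Defensive.

Import Order.TTheory GRing.Theory Num.Theory.
Import numFieldNormedType.Exports.

Local Open Scope ring_scope.

(** A nonzero difference would vanish at the distinct points 0, 1, ..., one more than its degree
    allows. This turns the pointwise [Dq] equations into equations between coefficients. *)
Lemma horner_inj (R : numDomainType) (p r : {poly R}) :
  (forall z, p.[z] = r.[z]) -> p = r.
Proof.
move=> pr; apply/eqP; rewrite -subr_eq0; apply/negPn/negP => d_neq0.
set d := p - r in d_neq0.
have := @max_poly_roots _ d [seq i%:R | i <- iota 0 (size d)] d_neq0.
rewrite size_map size_iota ltnn => /(_ _ _)/negP; apply => //.
- by apply/allP => x _; rewrite /root /d !hornerE pr subrr.
- by rewrite map_inj_uniq ?iota_uniq//; apply: mulrIn; rewrite oner_eq0.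
Qed.

Section QCalculus.
Context (R : realType) (q : R).
Hypotheses (hq0 : 0 < q) (hq1 : q < 1).
Implicit Types (p : {poly R}) (g x : nat -> R).

Lemma qint_neq0 m : qint q m.+1 != 0.
Proof.
rewrite /qint mulf_neq0 ?invr_eq0 ?subr_eq0 ?gt_eqF//.
by rewrite exprn_ilt1// ltW.
Qed.

Lemma qfactS m : qfact q m.+1 = qfact q m * qint q m.+1.
Proof. by rewrite /qfact big_nat_recr. Qed.

Lemma qfact0 : qfact q 0 = 1.
Proof. by rewrite /qfact big_geq. Qed.

Lemma qfact_neq0 m : qfact q m != 0.
Proof.
by elim: m => [|m IH]; rewrite ?qfact0 ?oner_eq0// qfactS mulf_neq0 ?qint_neq0.
Qed.

Definition qderiv p : {poly R} :=
  \poly_(i < (size p).-1) (qint q i.+1 * p`_i.+1).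

Lemma coef_qderiv p i : (qderiv p)`_i = qint q i.+1 * p`_i.+1.
Proof.
rewrite coef_poly; case: ltnP => // h.
by rewrite nth_default ?mulr0//; case: (size p) h.
Qed.

(** An equality of functions, so that it rewrites under an iterated [Dq]. At 0 the ordinary
    derivative agrees because [qint q 1] is 1. *)
Lemma Dq_horner p : Dq q (horner p) = horner (qderiv p).
Proof.
apply/funext => z; rewrite /Dq; case: eqVneq => [->|z0].
  rewrite -derivE !horner_coef0 coef_qderiv coef_deriv /qint expr1 divff ?mul1r//.
  by rewrite subr_eq0 gt_eqF.
have q1 : q - 1 != 0 by rewrite subr_eq0 lt_eqF.
have q1' : 1 - q != 0 by rewrite subr_eq0 gt_eqF.
apply: (mulIf (mulf_neq0 q1 z0)); rewrite divfK ?mulf_neq0//.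
(* Padding with a zero coefficient lets the constant term cancel and leaves [size p] terms to match
   with [qderiv p]. *)
rewrite !(@horner_coef_wide _ (size p).+1 p)// -sumrB big_ord_recl/= !expr0 subrr.
rewrite add0r (@horner_coef_wide _ (size p) (qderiv p)); last first.
  by rewrite (leq_trans (size_poly _ _))// leq_pred.
rewrite mulr_suml; apply: eq_bigr => i _.
by rewrite coef_qderiv /bump/= add1n /qint exprMn exprS [z ^+ _]exprS; field.
Qed.

Lemma coef_conjugate_seq g n i : (conjugate_seq q g n)`_i =
  if ~~ odd i && (i <= n.*2)%N then qbinom q n.*2 i * g (n - i./2)%N else 0.
Proof.
rewrite /conjugate_seq coef_sum.
under eq_bigr do rewrite coefZ coefXn.
case: ifPn => [/andP[oi ile]|].
  have iE : i = i./2.*2 by lia.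
  have i2n : i./2 \in index_iota 0 n.+1 by rewrite mem_index_iota; lia.
  rewrite (bigD1_seq i./2) ?iota_uniq//=.
  rewrite -iE eqxx mulr1 big1 ?addr0// => k ki.
  by rewrite (_ : i == k.*2 = false) ?mulr0//; lia.
move=> h; rewrite big_nat_cond big1// => k kn.
by rewrite (_ : i == k.*2 = false) ?mulr0//; lia.
Qed.

(* The normalised coefficients [i]_q! / [2n]_q! * (omega n)`_i depend only on
   2n - i, so everything reduces to the coefficients of degree 0 and 1. *)
Lemma qELS_I_expansion (omega : nat -> {poly R}) n : qELS_I q omega ->
  omega n = conjugate_seq q (assoc_seq omega) n.
Proof.
move=> [D2 D1 [c _ omega0]].
have coef1 m : (omega m)`_1 = 0.
  have := D1 m; rewrite Dq_horner horner_coef0 coef_qderiv => /eqP.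
  by rewrite mulf_eq0 (negPf (qint_neq0 0)) => /eqP.
have coefSS m i : qint q i.+2 * qint q i.+1 * (omega m.+1)`_i.+2 =
    qint q m.+1.*2 * qint q m.*2.+1 * (omega m)`_i.
  have D2m : qderiv (qderiv (omega m.+1)) =
      (qint q m.+1.*2 * qint q m.*2.+1) *: omega m.
    by apply: horner_inj => z; rewrite hornerZ -!Dq_horner D2.
  by have /polyP/(_ i) := D2m; rewrite !coef_qderiv coefZ => <-; ring.
apply/polyP => i; rewrite coef_conjugate_seq.
(* [coefSS] links degree i + 2 to degree i, so only degrees 0 and 1 are free: the former is
   [assoc_seq omega] by definition, the latter is zero by [coef1]. *)
elim: n i => [|n IH] [|[|i]].
- by rewrite /= /qbinom !qfact0 !mul1r invr1 mul1r /assoc_seq horner_coef0.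
- by rewrite coef1.
- by rewrite omega0 coefC leqn0 andbF.
- rewrite /= /qbinom qfact0 mul1r !subn0 divff ?qfact_neq0// mul1r.
  by rewrite /assoc_seq horner_coef0.
- by rewrite coef1.
- apply: (mulfI (mulf_neq0 (qint_neq0 i.+1) (qint_neq0 i))).
  rewrite coefSS IH doubleS !ltnS/= negbK subSS.
  case: ifP => _; last by rewrite !mulr0.
  rewrite /qbinom !subSS !qfactS.
  have := (qfact_neq0 i, qfact_neq0 (n.*2 - i), qint_neq0 i, qint_neq0 i.+1).
  by move=> [[[? ?] ?] ?]; field; apply/and4P.
Qed.

Lemma reciprocal_seq_sym g x : reciprocal_seq q g x -> reciprocal_seq q x g.
Proof.
move=> gx n; rewrite -(gx n) big_nat_rev/=; apply: eq_big_nat => j jn.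
by rewrite add0n subSS subKn ?[g j * _]mulrC ?[qfact q j.*2 * _]mulrC//; lia.
Qed.

Lemma reciprocal_seq_neq0 g x : reciprocal_seq q g x -> g 0%N != 0.
Proof.
move=> /(_ 0%N); rewrite big_nat1 => gx; apply/eqP => g0.
by move: gx => /eqP; rewrite g0 !mul0r eq_sym oner_eq0.
Qed.

(** In the coefficient of degree 2m the two q-binomials multiply to [2n]!/[2m]! times 1/([2(n-k)]!
    [2(k-m)]!), so the sum over k from m to n is the reciprocity relation at index n - m. *)
Lemma qbinom_conjugate_sum g x n : reciprocal_seq q g x ->
  \sum_(0 <= k < n.+1) (qbinom q n.*2 k.*2 * x (n - k)%N) *: conjugate_seq q g k
  = 'X^(n.*2).
Proof.
move=> gx; apply/polyP => i; rewrite coef_sum coefXn.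
under eq_bigr do rewrite coefZ coef_conjugate_seq.
have [odd_i|even_i] := boolP (odd i).
  rewrite big1 => [|k _]; last by rewrite mulr0.
  by rewrite (_ : i == n.*2 = false)//; lia.
have {even_i} -> : i = i./2.*2 by lia.
move: i./2 => m {i}; rewrite doubleK/=.
have [mn|nm] := leqP m n; last first.
  rewrite big_nat_cond big1 => [|k kn]; last first.
    by rewrite leq_double leqNgt (_ : k < m)%N ?mulr0//; lia.
  by rewrite (_ : m.*2 == n.*2 = false)//; lia.
rewrite (@big_cat_nat _ _ _ m)//=; last by lia.
rewrite [X in X + _]big_nat_cond big1 ?add0r => [|k kn]; last first.
  by rewrite leq_double leqNgt (_ : k < m)%N ?mulr0//; lia.
(* The inserted factor is 1 when m = n and is multiplied by 0 otherwise; it is the constant common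
   to all the terms on the left. *)
have -> : (m.*2 == n.*2)%:R =
    qfact q n.*2 / qfact q m.*2 * (n - m == 0)%N%:R :> R.
  have [->|h] := eqVneq m n.
    by rewrite subnn !eqxx divff ?qfact_neq0 ?mulr1.
  have [-> ->] : m.*2 == n.*2 = false /\ (n - m == 0)%N = false by lia.
  by rewrite mulr0.
rewrite -(gx (n - m)%N) mulr_sumr -{1}(add0n m) big_addn subSn//.
apply: eq_big_nat => j jn; rewrite leq_double leq_addl addnK /qbinom.
have -> : (n - (j + m) = n - m - j)%N by lia.
have -> : (n.*2 - (j + m).*2 = (n - m - j).*2)%N by lia.
have -> : ((j + m).*2 - m.*2 = j.*2)%N by lia.
have := (qfact_neq0 m.*2, qfact_neq0 (n - m - j).*2, qfact_neq0 j.*2,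
  qfact_neq0 (j + m).*2).
by move=> [[[? ?] ?] ?]; field; apply/and4P.
Qed.

Lemma conjugate_seq_rec g x n : reciprocal_seq q g x ->
  conjugate_seq q g n = (x 0%N)^-1 *: ('X^(n.*2) -
    \sum_(0 <= k < n) (qbinom q n.*2 k.*2 * x (n - k)%N) *: conjugate_seq q g k).
Proof.
move=> gx; have x0 := reciprocal_seq_neq0 (reciprocal_seq_sym gx).
rewrite -(qbinom_conjugate_sum n gx) big_nat_recr//= addrAC subrr add0r subnn.
rewrite /qbinom subnn qfact0 mulr1 divff ?qfact_neq0// mul1r.
by rewrite scalerA mulVf ?scale1r.
Qed.

End QCalculus.

Theorem theorem3p12 (R : realType) (q : R) (hq0 : 0 < q) (hq1 : q < 1)
    (omega : nat -> {poly R}) (homega : qELS_I q omega)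
    (xi : nat -> R) (hxi : reciprocal_seq q (assoc_seq omega) xi) (n : nat) :
  omega n =
    (xi 0%N)^-1 *: ('X^(n.*2) -
      \sum_(0 <= k < n)
        (qbinom q n.*2 k.*2 * xi (n - k)%N) *: omega k)
  /\
  conjugate_seq q xi n =
    (assoc_seq omega 0%N)^-1 *: ('X^(n.*2) -
      \sum_(0 <= k < n)
        (qbinom q n.*2 k.*2 * assoc_seq omega (n - k)%N) *:
          conjugate_seq q xi k).
Proof.
split; last exact/conjugate_seq_rec/reciprocal_seq_sym.
(* Each [omega k] is the conjugate-type polynomial built from [assoc_seq omega], so the same
   recurrence lemma serves both halves. *)
rewrite (qELS_I_expansion hq0 hq1 n homega).
rewrite (conjugate_seq_rec hq0 hq1 n hxi); congr (_ *: (_ - _)).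
by apply: eq_bigr => k _; rewrite -qELS_I_expansion.
Qed.
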